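(* $\operatorname{Dist}(\mathrm{PX}(3,2))=2$ and $\rho(\mathrm{PX}(3,2))=3$.
   Context: For integers $n\ge 3$ and $1\le k<n$, the Praeger–Xu graph $\mathrm{PX}(n,k)$ is the simple graph with vertex set $\mathbb Z_n\times\mathbb Z_2^k$; a vertex is written $(i,x)$ with $x=x_0x_1\cdots x_{k-1}$ a bitstring of length $k$. Two vertices $(i,x)$ and $(j,y)$ are adjacent if and only if (after possibly swapping the two vertices) $j=i+1$ in $\mathbb Z_n$ and $x=az_1\cdots z_{k-1}$, $y=z_1\cdots z_{k-1}b$ for some bits $a,b,z_1,\dots,z_{k-1}\in\mathbb Z_2$. For a graph $G$, $\operatorname{Dist}(G)$ is the least $d$ such that some $d$-coloring of the vertices is preserved (class-wise) only by the identity automorphism; if $\operatorname{Dist}(G)=2$, $\rho(G)$ is the minimum size of a color class over all 2-colorings preserved only by the identity automorphism. *)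

(* Defs.v *)
From HB Require Import structures.
From mathcomp Require Import all_boot all_order all_fingroup all_algebra.

Set Implicit Arguments.
Unset Strict Implicit.
Unset Printing Implicit Defensive.

(* A graph on a finite vertex type T is given by its adjacency relation. *)
Section Distinguishing.
Variables (T : finType) (e : rel T).

Definition automorphism (s : {perm T}) : bool :=
  [forall u, forall v, e (s u) (s v) == e u v].

(* Colorings need be neither proper nor surjective. *)
Definition preserves (d : nat) (c : {ffun T -> 'I_d}) (s : {perm T}) : bool :=
  [forall v, c (s v) == c v].

Definition distinguishing (d : nat) (c : {ffun T -> 'I_d}) : bool :=
  [forall s : {perm T}, automorphism s ==> preserves c s ==> (s == 1%g)].

Definition distinguishable (d : nat) : bool :=
  [exists c : {ffun T -> 'I_d}, distinguishing c].

Lemma ex_distinguishable : exists d, distinguishable d.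
Proof.
exists #|T|; apply/existsP; exists [ffun v => enum_rank v].
apply/forallP => s; apply/implyP => _; apply/implyP => /forallP cs.
apply/eqP/permP => v; rewrite perm1; apply: enum_rank_inj.
by have := cs v; rewrite !ffunE => /eqP.
Qed.

Definition Dist : nat := ex_minn ex_distinguishable.

(* Every color class has at most #|T| elements, so the default #|T| is neutral;
   it is the (meaningless) value when no distinguishing 2-coloring exists. *)
Definition rho : nat :=
  \big[minn/#|T|]_(c : {ffun T -> 'I_2} | distinguishing c)
    \big[minn/#|T|]_(i < 2) #|[set v | c v == i]|.

End Distinguishing.

(* 'Z_n is the ring of integers mod n only for n > 1, which n >= 3 ensures. *)
Definition PX_vertex (n k : nat) : finType := ('Z_n * k.-tuple bool)%type.

Definition PX_arc (n k : nat) (u v : PX_vertex n k) : bool :=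
  (v.1 == u.1 + 1)%R &&
  [exists a : bool, exists b : bool, exists z : k.-1.-tuple bool,
     (u.2 == a :: z :> seq bool) && (v.2 == rcons z b :> seq bool)].

Definition PX (n k : nat) : rel (PX_vertex n k) :=
  fun u v => PX_arc u v || PX_arc v u.

Lemma PX_sym (n k : nat) : symmetric (@PX n k).
Proof. by move=> u v; rewrite /PX orbC. Qed.

Lemma PX_irr (n k : nat) : irreflexive (@PX n k).
Proof.
move=> u; rewrite /PX orbb /PX_arc -[X in X == _]GRing.addr0.
by rewrite (inj_eq (GRing.addrI _)) eq_sym GRing.oner_eq0.
Qed.

(* Main.v *)
Require Import Defs.
From mathcomp Require Import all_boot all_order all_fingroup all_algebra.

(** A vertex of PX(3,2) assigns bits to two of the three positions in Z_3, that
is, it is an edge of the 3-cube, and two vertices are adjacent exactly when the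
edges share one endpoint; so PX(3,2) is the line graph of the cube, and the
signed permutations of the coordinates act on it.

Any two edges of the cube are fixed or exchanged by a nontrivial signed
permutation: parallel edges are fixed by the reflection along their common
direction, and nonparallel ones are exchanged by transposing their directions
and flipping suitable coordinates. Hence a color class of a distinguishing
2-coloring has at least three elements.

Conversely, an automorphism preserving f preserves 3f + A(f^2), where A is the
adjacency operator. Starting from the indicator function of {000, 011, 100}
(written i x_0 x_1), two such steps give an injective function, so that only the
identity preserves that set. *)

Set Implicit Arguments.
Unset Strict Implicit.
Unset Printing Implicit Defensive.

Import Order.TTheory.

(** A numerical form of color refinement. The factor 3 and the square serve to separate all twelve
    vertices in two rounds, see [PX32_invariant_injective]. *)
Definition adjacency_step (T : finType) (e : rel T) (f : T -> nat) (v : T) :=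
  3 * f v + \sum_(w | e v w) f w * f w.

Lemma adjacency_step_invariant (T : finType) (e : rel T) (f : T -> nat)
    (s : {perm T}) :
  automorphism e s -> f \o s =1 f ->
  adjacency_step e f \o s =1 adjacency_step e f.
Proof.
move=> /forallP es fs v /=; rewrite /adjacency_step -[f (s v)]/((f \o s) v) fs.
congr addn; rewrite (reindex_inj (@perm_inj _ s)) /=.
apply: eq_big => [w|w _]; first by have /forallP/(_ w)/eqP := es v.
by rewrite -[f (s w)]/((f \o s) w) fs.
Qed.

Definition PX32_vertices : seq (PX_vertex 3 2) :=
  [seq (i, x) | i <- [:: 0; 1; 1 + 1]%R,
                x <- [seq [tuple a; b] | a <- [:: false; true],
                                         b <- [:: false; true]]].

Lemma mem_PX32_vertices u : u \in PX32_vertices.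
Proof.
case: u => i x; apply/allpairsP; exists (i, x); split=> //=.
  by case: i => -[|[|[|?]]].
case/tupleP: x => a x; case/tupleP: x => b x; rewrite (tuple0 x).
by case: a b => -[].
Qed.

Lemma uniq_PX32_vertices : uniq PX32_vertices.
Proof. by vm_compute. Qed.

(* [PX] itself does not compute, because of its existential quantifiers. *)
Definition PX32_arc (u v : PX_vertex 3 2) :=
  (v.1 == u.1 + 1)%R && (nth false u.2 1 == nth false v.2 0).

Lemma PX32_arcE u v : @PX_arc 3 2 u v = PX32_arc u v.
Proof.
case: u v => i x [j y]; rewrite /PX_arc /PX32_arc /=; congr andb.
case/tupleP: x => a x; case/tupleP: x => b x; rewrite (tuple0 x).
case/tupleP: y => c y; case/tupleP: y => d y; rewrite (tuple0 y) /=.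
apply/idP/eqP => [|<-].
  move=> /existsP[? /existsP[? /existsP[z /andP[]]]].
  case/tupleP: z => z z'; rewrite (tuple0 z') /=.
  by move=> /eqP[_ ->] /eqP[-> _].
by apply/existsP; exists a; apply/existsP; exists d; apply/existsP;
  exists [tuple b]; rewrite !eqxx.
Qed.

Definition PX32 (u v : PX_vertex 3 2) := PX32_arc u v || PX32_arc v u.

Lemma PX32E : @PX 3 2 =2 PX32.
Proof. by move=> u v; rewrite /PX !PX32_arcE. Qed.

Definition bit_at (u : PX_vertex 3 2) (p : 'Z_3) := nth false u.2 (p != u.1).

(* For an involution [g]. The position to which [u] assigns no bit, i.e. the
   direction of the corresponding edge of the cube, is [u.1 - 1]. *)
Definition signed_permutation (g : 'Z_3 -> 'Z_3) (t : 'Z_3 -> bool)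
    (u : PX_vertex 3 2) : PX_vertex 3 2 :=
  let i := (g (u.1 - 1) + 1)%R in
  (i, [tuple bit_at u (g i) (+) t i; bit_at u (g (i + 1)%R) (+) t (i + 1)%R]).

(** For [i != j], the flips agree at [i] and [j], which makes the map an involution, and their
    values make it exchange [x] and [y]. Passing through [q] avoids position [i], where [x] has no
    bit and [bit_at x] is meaningless. *)
Definition pair_symmetry (x y : PX_vertex 3 2) : PX_vertex 3 2 -> _ :=
  let i := (x.1 - 1)%R in let j := (y.1 - 1)%R in
  let g p := if p == i then j else if p == j then i else p in
  signed_permutation g (fun p =>
    if i == j then p == i
    else let q := if p == i then j else p in bit_at x q (+) bit_at y (g q)).

Lemma PX32_forall2 (P : PX_vertex 3 2 -> PX_vertex 3 2 -> bool) :
  all (fun x => all (P x) PX32_vertices) PX32_vertices -> forall x y, P x y.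
Proof.
move=> /allP PV x y; have /allP := PV x (mem_PX32_vertices x).
by apply; apply: mem_PX32_vertices.
Qed.

Lemma pair_symmetryK x y : involutive (pair_symmetry x y).
Proof.
suff /(_ x y)/allP sK : forall x y,
    all (fun u => pair_symmetry x y (pair_symmetry x y u) == u) PX32_vertices.
  by move=> u; apply/eqP/sK/mem_PX32_vertices.
by apply: PX32_forall2; vm_compute.
Qed.

(** Only adjacency can be concluded: transposing two directions reverses the cyclic order of ['Z_3],
    hence every arc. *)
Lemma pair_symmetry_arc x y u v :
  PX32_arc u v -> PX32 (pair_symmetry x y u) (pair_symmetry x y v).
Proof.
suff /(_ x y)/allP arcP : forall x y,
    all (fun u => let su := pair_symmetry x y u in
           all (fun v => PX32 su (pair_symmetry x y v))
               [seq v <- PX32_vertices | PX32_arc u v]) PX32_vertices.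
  move=> uv; have /allP := arcP u (mem_PX32_vertices u); apply.
  by rewrite mem_filter uv mem_PX32_vertices.
by apply: PX32_forall2; vm_compute.
Qed.

Lemma pair_symmetry_automorphism x y u v :
  PX32 (pair_symmetry x y u) (pair_symmetry x y v) = PX32 u v.
Proof.
have sP u' v' :
    PX32 u' v' -> PX32 (pair_symmetry x y u') (pair_symmetry x y v').
  by case/orP => /pair_symmetry_arc-/(_ x y) //; rewrite /PX32 orbC.
by apply/idP/idP => [/sP|/sP //]; rewrite !pair_symmetryK.
Qed.

Lemma pair_symmetry_pair x y :
  (pair_symmetry x y x == x) && (pair_symmetry x y y == y) ||
  (pair_symmetry x y x == y) && (pair_symmetry x y y == x).
Proof. by move: x y; apply: PX32_forall2; vm_compute. Qed.

Lemma pair_symmetry_nontrivial x y : exists u, pair_symmetry x y u != u.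
Proof.
suff /(_ x y)/hasP[u _ su] : forall x y,
    has (fun u => pair_symmetry x y u != u) PX32_vertices by exists u.
by apply: PX32_forall2; vm_compute.
Qed.

Lemma PX32_pair_automorphism (x y : PX_vertex 3 2) :
  exists s : {perm PX_vertex 3 2},
    [/\ automorphism (@PX 3 2) s, s != 1%g
      & forall v, (s v \in [:: x; y]) = (v \in [:: x; y])].
Proof.
pose s := perm (inv_inj (pair_symmetryK x y)); exists s; split.
- apply/forallP => u; apply/forallP => v.
  by rewrite !PX32E !permE pair_symmetry_automorphism.
- have [u] := pair_symmetry_nontrivial x y.
  rewrite -(permE (inv_inj (pair_symmetryK x y))) -/s.
  by apply: contraNneq => ->; rewrite perm1.
have sP v : v \in [:: x; y] -> s v \in [:: x; y].
  rewrite !inE !permE; have := pair_symmetry_pair x y.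
  by case/orP => /andP[/eqP sx /eqP sy] /orP[]/eqP->;
    rewrite ?sx ?sy eqxx ?orbT.
move=> v; apply/idP/idP => [/sP|/sP //].
by rewrite !permE pair_symmetryK.
Qed.

Lemma card_lt3_sub_pair (T : finType) (x0 : T) (A : {set T}) :
  #|A| < 3 -> exists x y, A = [set x; y] \/ A = set0.
Proof.
case cardA: #|A| => [|[|[|//]]] _.
- by exists x0, x0; right; apply/eqP; rewrite -cards_eq0 cardA.
- by have /eqP/cards1P[x ->] := cardA; exists x, x; rewrite setUid; left.
- by have /eqP/cards2P[x [y [_ ->]]] := cardA; exists x, y; left.
Qed.

Lemma PX32_small_set_automorphism (A : {set PX_vertex 3 2}) :
  #|A| < 3 -> exists s : {perm PX_vertex 3 2},
    [/\ automorphism (@PX 3 2) s, s != 1%g & forall v, (s v \in A) = (v \in A)].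
Proof.
move=> /(card_lt3_sub_pair (0%R, [tuple false; false]))[x [y Axy]].
have [s [es s1 sP]] := PX32_pair_automorphism x y; exists s; split=> // v.
by have := sP v; case: Axy => ->; rewrite !inE.
Qed.

Lemma PX32_color_class_ge3 (c : {ffun PX_vertex 3 2 -> 'I_2}) i :
  distinguishing (@PX 3 2) c -> 3 <= #|[set v | c v == i]|.
Proof.
move=> /forallP cP; rewrite leqNgt; apply/negP.
case/PX32_small_set_automorphism => s [es s1 sP].
have := cP s; rewrite es (negPf s1) implybF => /negP; apply.
(* With only two colors, preserving one class preserves the coloring. *)
apply/forallP => v; have := sP v; rewrite !inE.
by case: (c (s v)) (c v) {sP} i => -[|[|//]] ? [[|[|//]] ?] [[|[|//]] ?].
Qed.

(** On the cube: two diagonally opposite parallel edges, and a third edge that meets only the first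
    of them. *)
Definition PX32_red : seq (PX_vertex 3 2) :=
  [:: (0%R, [tuple false; false]); (0%R, [tuple true; true]);
      (1%R, [tuple false; false])].

Definition PX32_coloring : {ffun PX_vertex 3 2 -> 'I_2} :=
  [ffun v => inord (v \in PX32_red)].

Lemma PX32_coloringE v (b : bool) :
  (PX32_coloring v == inord b) = ((v \in PX32_red) == b).
Proof.
rewrite ffunE -val_eqE /= !inordK ?ltnS ?leq_b1 //.
by case: b; case: (v \in _).
Qed.

Definition PX32_step (f : PX_vertex 3 2 -> nat) v :=
  3 * f v + sumn [seq f w * f w | w <- PX32_vertices & PX32 v w].

Lemma PX32_stepE f : adjacency_step (@PX 3 2) f =1 PX32_step f.
Proof.
move=> v; rewrite /adjacency_step /PX32_step; congr addn.
rewrite sumnE big_map big_filter (eq_bigl _ _ (PX32E v)); apply: perm_big.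
apply: uniq_perm => [||w]; [exact: index_enum_uniq|exact: uniq_PX32_vertices|].
by rewrite mem_index_enum mem_PX32_vertices.
Qed.

Lemma PX32_step_invariant (f : PX_vertex 3 2 -> nat)
    (s : {perm PX_vertex 3 2}) :
  automorphism (@PX 3 2) s -> f \o s =1 f -> PX32_step f \o s =1 PX32_step f.
Proof.
move=> es fs v; rewrite /= -!PX32_stepE.
exact: (adjacency_step_invariant es fs).
Qed.

Lemma PX32_invariant_injective :
  injective (PX32_step (PX32_step (fun v => v \in PX32_red))).
Proof.
set f := PX32_step _; apply/injectiveP.
(* Distinctness of the twelve values does not depend on their order, so a list that computes can
   replace [enum]. *)
have enumE : perm_eq (enum (PX_vertex 3 2)) PX32_vertices.
  apply: uniq_perm => [||w]; [exact: enum_uniq|exact: uniq_PX32_vertices|].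
  by rewrite mem_enum mem_PX32_vertices.
rewrite /injectiveb /dinjectiveb (perm_uniq (perm_map f enumE)).
by vm_compute.
Qed.

Lemma PX32_coloring_distinguishing : distinguishing (@PX 3 2) PX32_coloring.
Proof.
apply/forallP => s; apply/implyP => es; apply/implyP => /forallP cs.
have redP : (fun v => v \in PX32_red : nat) \o s =1 (fun v => v \in PX32_red).
  move=> v /=; congr nat_of_bool; apply/eqP.
  by rewrite -PX32_coloringE (eqP (cs v)) PX32_coloringE.
apply/eqP/permP => v; rewrite perm1; apply: PX32_invariant_injective.
exact: (PX32_step_invariant es (PX32_step_invariant es redP)).
Qed.

Theorem theorem5p5 : Dist (@PX 3 2) = 2 /\ rho (@PX 3 2) = 3.
Proof.
have dist2 : distinguishable (@PX 3 2) 2.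
  by apply/existsP; exists PX32_coloring; apply: PX32_coloring_distinguishing.
split.
  rewrite /Dist; case: ex_minnP => -[|[|d]] /existsP[c].
  - by case: (c (0%R, [tuple false; false])).
  (* One color is preserved by every automorphism, so any nontrivial one will do. *)
  - have [|s [es s1 _]] := @PX32_small_set_automorphism set0.
      by rewrite cards0.
    move=> /forallP/(_ s); rewrite es (negPf s1) implybF => /negP[].
    by apply/forallP => v; rewrite !ord1.
  - by move=> _ /(_ 2 dist2); case: d {c}.
(* The default value of both minima in [rho] must also be at least 3. *)
have card3 : 3 <= #|PX_vertex 3 2|.
  by apply: leq_trans (max_card (mem PX32_red)); rewrite (card_uniqP _).
apply/eqP; rewrite eqn_leq; apply/andP; split; last first.
  apply: (big_ind (leq 3)) => // [m n|c cP]; first by rewrite leq_min => -> ->.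
  apply: (big_ind (leq 3)) => // [m n|i _]; first by rewrite leq_min => -> ->.
  exact: PX32_color_class_ge3.
rewrite /rho -minEnat.
apply: (@bigmin_inf _ nat _ _ PX32_coloring _ _ _ PX32_coloring_distinguishing).
apply: (bigmin_inf (inord true : 'I_2)) => //.
have -> : [set v | PX32_coloring v == inord true] = [set v in PX32_red].
  by apply/setP => v; rewrite !in_set (PX32_coloringE v true) eqb_id.
by rewrite cardsE leEnat (card_uniqP _).
Qed.
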